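(* Let $(\Omega,\mathfrak{F},P)$ be a probability space, let $Z$ be a random element on it with values in an arbitrary measurable space $(\mathfrak{S},\mathfrak{T})$, and let $1\le p,q\le\infty$ be a pair of conjugate exponents. Let $X\in\mathcal{L}_p$ and $Y\in\mathcal{L}_q$ be real valued random variables on $(\Omega,\mathfrak{F},P)$. Consider the following two conditions. (A) There exist measurable functions $\alpha,\beta:(\mathfrak{S},\mathfrak{T})\to(\mathbb{R},\mathcal{B}(\mathbb{R}))$ with $\alpha(Z)\in\mathcal{L}_1$ and $\alpha(Z)X\in\mathcal{L}_1$ such that $\mathrm{E}^{X,Z}(Y)=\alpha(Z)+\beta(Z)X$. (B) There exist measurable functions $\gamma,\delta:(\mathfrak{S},\mathfrak{T})\to(\mathbb{R},\mathcal{B}(\mathbb{R}))$ with $\gamma(Z)\in\mathcal{L}_1$ and $\gamma(Z)Y\in\mathcal{L}_1$ such that $\mathrm{E}^{Y,Z}(X)=\gamma(Z)+\delta(Z)Y$. Then the following seven conclusions hold: (i) $\max(p,q)\ge 2$ and $\min(p,q)\le 2$. (ii) If $\mathrm{E}^{X,Z}(Y)=\mathrm{E}^{Z}(Y)$, then $\mathrm{Cov}^Z(X,Y)=0$ and (A) holds. (iii) If $p\ge 2$ and (A) holds with functions $\alpha,\beta$, then $$\alpha(Z)=\mathrm{E}^Z(Y)-\beta(Z)\,\mathrm{E}^Z(X)\quad\text{and}\quad \beta(Z)=\frac{\mathrm{Cov}^Z(X,Y)}{\mathrm{Var}^Z(X)}\,[\mathrm{Var}^Z(X)>0].$$ (iv)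 If $p\ge 2$ and (A) holds, then $\mathrm{Cov}^Z(X,Y)=0$ implies $\mathrm{E}^{X,Z}(Y)=\mathrm{E}^{Z}(Y)$. (v) If $\mathrm{E}^{Y,Z}(X)=\mathrm{E}^{Z}(X)$, then $\mathrm{Cov}^Z(X,Y)=0$ and (B) holds. (vi) If $q\ge 2$ and (B) holds with functions $\gamma,\delta$, then $$\gamma(Z)=\mathrm{E}^Z(X)-\delta(Z)\,\mathrm{E}^Z(Y)\quad\text{and}\quad \delta(Z)=\frac{\mathrm{Cov}^Z(X,Y)}{\mathrm{Var}^Z(Y)}\,[\mathrm{Var}^Z(Y)>0].$$ (vii) If $q\ge 2$ and (B) holds, then $\mathrm{Cov}^Z(X,Y)=0$ implies $\mathrm{E}^{Y,Z}(X)=\mathrm{E}^{Z}(X)$.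
   Context: All equalities and inequalities between random variables are understood to hold $P$-almost surely. $\mathcal{L}_p=\mathcal{L}_p(\Omega,\mathfrak{F},P)$ is the space of real valued random variables with finite $p$-th absolute moment for $1\le p<\infty$, and the space of essentially bounded random variables for $p=\infty$. Conjugate exponents satisfy $p^{-1}+q^{-1}=1$ (with $1$ and $\infty$ conjugate). $\mathcal{B}(\mathbb{R})$ is the Borel $\sigma$-algebra of $\mathbb{R}$. For a random element $W$, $\mathrm{E}^{W}(\cdot)$ denotes conditional expectation given $\sigma(W)$; $\mathrm{E}^{X,Z}$ and $\mathrm{E}^{Y,Z}$ denote conditional expectation given $\sigma(X,Z)$ and $\sigma(Y,Z)$. An event is identified with its indicator function, so $[\mathrm{Var}^Z(X)>0]$ is the indicator of that event; a quotient multiplied by the indicator of the event that its denominator is positive is taken to be $0$ where the denominator vanishes. For $X\in\mathcal{L}_p$, $Y\in\mathcal{L}_q$ with $p,q$ conjugate, the conditional covariance is $\mathrm{Cov}^Z(X,Y)=\mathrm{E}^Z\big((X-\mathrm{E}^Z(X))(Y-\mathrm{E}^Z(Y))\big)=\mathrm{E}^Z(XY)-\mathrm{E}^Z(X)\mathrm{E}^Z(Y)$. For a real random variable $U$ in $\mathcal{L}_r$ with $r\ge 2$, the conditional variance is $\mathrm{Var}^Z(U)=\mathrm{E}^Z\big((U-\mathrm{E}^Z(U))^2\big)=\mathrm{E}^Z(U^2)-(\mathrm{E}^Z(U))^2$.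
   Formalization: In (iii) and (vi) the formula for β(Z) (resp. δ(Z)) is claimed only on the event that the conditional variance is positive, since β, δ are arbitrary where it vanishes; added: some pair as in (A) (resp. (B)) satisfies both formulas everywhere. *)

(* Defs.v *)
From HB Require Import structures.
From mathcomp Require Import all_boot all_order all_algebra.
From mathcomp Require Import all_classical all_reals all_analysis.
From mathcomp Require Import measurable_realfun ess_sup_inf.

Set Implicit Arguments.
Unset Strict Implicit.
Unset Printing Implicit Defensive.

Import Order.TTheory GRing.Theory Num.Theory.
Import numFieldNormedType.Exports.

Local Open Scope classical_set_scope.
Local Open Scope ring_scope.

Section conditional_expectation.
Context {d d' : measure_display} {T : measurableType d} {S : measurableType d'}.
Context {R : realType} (P : probability T R) (W : T -> S).

(* V is a version of the conditional expectation of U given sigma(W);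
   [g_sigma_algebra_preimageType W] is T equipped with sigma(W), the sigma
   algebra of the sets W @^-1` B with B measurable. *)
Definition is_condexp (U V : T -> R) : Prop :=
  [/\ measurable_fun [set: g_sigma_algebra_preimageType W]
        (V : g_sigma_algebra_preimageType W -> R),
      P.-integrable setT (EFin \o V) &
      forall A : set T, g_sigma_algebra_preimage W A ->
        (\int[P]_(w in A) (V w)%:E = \int[P]_(w in A) (U w)%:E)%E].

(* A chosen version; [condexpP] below shows that one exists whenever U is in
   L^1, so that the default value is irrelevant for such U. *)
Definition condexp (U : T -> R) : T -> R := xget (cst 0) [set V | is_condexp U V].

Definition condcov (X Y : T -> R) : T -> R :=
  condexp (fun w => (X w - condexp X w) * (Y w - condexp Y w)).

Definition condvar (U : T -> R) : T -> R :=
  condexp (fun w => (U w - condexp U w) ^+ 2).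

Lemma condexpP (U : T -> R) : measurable_fun setT W -> U \in Lfun P 1 ->
  is_condexp U (condexp U).
Proof.
move=> mW /Lfun1_integrable iU.
suff [V VP] : exists V, is_condexp U V by exact: (xgetI (cst 0) VP).
pose W' : {mfun T >-> S} := mfun_Sub (mem_set mW : W \in mfun).
pose mu := distribution P W'.
have nuP : pushforward (induced_charge iU) W `<< mu.
  apply: dominates_pushforward => //; apply/null_content_dominatesP => A mA PA.
  apply: null_set_integral => //.
  by apply: measurable_funTS; exact: measurable_int iU.
have [h [hm ih hE]] :
    exists h : S -> R, [/\ measurable_fun setT h,
      mu.-integrable setT (EFin \o h) & forall B, measurable B ->
      (\int[P]_(w in W @^-1` B) (U w)%:E = \int[mu]_(y in B) (h y)%:E)%E].
  pose nu : {charge set S -> \bar R} :=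
    @measure_function_pushforward__canonical__charge_Charge
      _ _ _ _ W R (induced_charge iU) mW.
  pose f := Radon_Nikodym nu mu.
  have fE : EFin \o (fine \o f) = f.
    by apply/funext => y /=; rewrite fineK// Radon_Nikodym_fin_num.
  have intf : mu.-integrable setT f by exact: Radon_Nikodym_integrable.
  exists (fine \o f); split.
  - by apply/measurable_EFinP; rewrite fE; exact: measurable_int intf.
  - by rewrite fE.
  - move=> B mB; have := Radon_Nikodym_integral (nuP : nu `<< mu) mB.
    rewrite -/f -fE => <-//.
have ihW : P.-integrable setT (EFin \o h \o W).
  apply/integrableP; split.
    by apply: measurableT_comp => //; exact/measurable_EFinP.
  move/integrableP : ih => [_]; rewrite ge0_integral_distribution//.
  by apply: measurableT_comp => //; exact/measurable_EFinP.
exists (h \o W); split => //.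
- move=> _ B mB; rewrite setTI; exists (h @^-1` B); last by rewrite setTI.
  by rewrite -[X in measurable X]setTI; exact: hm.
- move=> _ [B mB <-]; rewrite setTI hE// /mu /distribution.
  rewrite integral_pushforward//; first exact/measurable_EFinP.
  apply: (integrableS measurableT) ihW => //.
  by move: (mW measurableT _ mB); rewrite setTI.
Qed.

End conditional_expectation.

(* E^{X,Z}(Y) = a(Z) + b(Z) X almost surely, with the integrability conditions
   on a(Z) and a(Z) X but none on b(Z). *)
Definition affine_condexp {d d' : measure_display} {T : measurableType d}
    {S : measurableType d'} {R : realType} (P : probability T R)
    (Z : T -> S) (X Y : T -> R) (a b : S -> R) : Prop :=
  [/\ measurable_fun setT a, measurable_fun setT b,
      (fun w => a (Z w)) \in Lfun P 1,
      (fun w => a (Z w) * X w) \in Lfun P 1 &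
      condexp P (fun w => (X w, Z w)) Y
        = (fun w => a (Z w) + b (Z w) * X w) %[ae P]].

(* Main.v *)
Require Import Defs.
From HB Require Import structures.
From mathcomp Require Import all_boot all_order all_algebra lra ring.
From mathcomp Require Import all_classical all_reals all_analysis.
From mathcomp Require Import measurable_realfun ess_sup_inf.

(** The proof runs on orthogonality rather than on conditional expectations
themselves.  Call an integrable variable D centered given W when its integral
over every event of sigma(W) vanishes, that is, when E(D | W) = 0.  A function
v(W) is then a version of E(U | W) exactly when U - v(W) is centered given W
([condexp_spec], [condexp_unique]); sigma(W)-measurable functions are always
written v(W), by Doob-Dynkin ([doob_dynkin]).  Three rules replace the calculus
of conditional expectations: a centered D stays centered after multiplication
by any g(W) for which the product is integrable ([centered_mul]); centering
given (X, Z) implies centering given Z ([centered_comp]); a centered function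
of W vanishes almost surely ([centered_eq0]).

Write x(Z), y(Z), e(X, Z) for the conditional expectations of X and Y given Z
and of Y given (X, Z).

If e(X, Z) = y(Z), then Y - y(Z) is centered given (X, Z), hence so is its
product with the (X, Z)-measurable X - x(Z), and the conditional covariance
vanishes; a = y and b = 0 give an affine representation.

If e(X, Z) = a(Z) + b(Z) X, centering given Z yields y = a + b x.  Therefore
Y - y(Z) - b(Z) (X - x(Z)) is centered given (X, Z); multiplying it by X - x(Z)
yields Cov = b(Z) Var.  Where Var > 0 this determines b.  Where Var = 0, X is
equal to x(Z), so that b may be replaced by 0 and a by y without changing
a + b X ([affine_condexp_slope]).  If Cov = 0, then at almost every point
either b = 0 or X = x(Z), and a + b X = y in both cases
([affine_condexp_uncorrelated]).

What costs effort is the integrability of the products.  Since nothing is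
assumed on b(Z), the integrability of b(Z) x(Z), b(Z) (X - x(Z))^2 and
b(Z) Var is recovered from the fact that g(W) U in L1 implies
g(W) E(U | W) in L1 ([condexp_mul_Lfun1]).  For products of X or x(Z) with Y or
y(Z) one uses Hoelder's inequality and the stability of L^p under conditional
expectation ([condexp_Lfun]).  The statements on E(X | Y, Z) follow by
exchanging the roles of X and Y. *)

Set Implicit Arguments.
Unset Strict Implicit.
Unset Printing Implicit Defensive.

Import Order.TTheory GRing.Theory Num.Theory.
Import numFieldNormedType.Exports.

Local Open Scope classical_set_scope.
Local Open Scope ring_scope.

(** * Measurability, indicators and integrability *)

Lemma measurable_sgr (R : realType) : measurable_fun setT (@Num.sg R).
Proof.
rewrite (_ : Num.sg = fun x : R => if 0 < x then 1 else if x < 0 then -1 else 0).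
  apply: measurable_fun_ifT => //; first exact: measurable_fun_ltr.
  by apply: measurable_fun_ifT => //; exact: measurable_fun_ltr.
by apply/funext => x; case: sgrP => // x0; rewrite ltNge (ltW x0).
Qed.

Lemma normr_sg_le1 {R : realDomainType} (x : R) : `|Num.sg x| <= 1.
Proof. by rewrite normr_sg; case: (_ != 0). Qed.

Lemma measurable_preim {d d' : measure_display} {T : measurableType d}
    {S : measurableType d'} (f : T -> S) (B : set S) :
  measurable_fun setT f -> measurable B -> measurable (f @^-1` B).
Proof. by move=> mf mB; rewrite -[X in measurable X]setTI; exact: mf. Qed.

Lemma measurable_abs_le {d : measure_display} {T : measurableType d}
    {R : realType} (h : T -> R) (c : R) :
  measurable_fun setT h -> measurable [set t | `|h t| <= c].
Proof.
move=> mh; rewrite -[X in measurable X]setTI.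
by apply: measurable_fun_le => //; exact: measurableT_comp.
Qed.

Lemma indic_mulE {T : Type} {R : pzRingType} (A : set T) (b : bool) (t : T) (x : R) :
  (A t <-> b) -> \1_A t * x = if b then x else 0.
Proof.
move=> Ab; rewrite indicE; case: ifPn => [/Ab At|/negP bN].
  by rewrite mem_set// mul1r.
by rewrite memNset ?mul0r// => /Ab.
Qed.

Section integrability.
Context {d : measure_display} {T : measurableType d} {R : realType}.
Variable P : probability T R.
Implicit Types f g : T -> R.

Lemma Lfun_measurable (p : \bar R) f : f \in Lfun P p -> measurable_fun setT f.
Proof. by rewrite inE => /andP[]; rewrite inE. Qed.

Lemma Lfun1D f g : f \in Lfun P 1 -> g \in Lfun P 1 ->
  (fun w => f w + g w) \in Lfun P 1.
Proof. by move=> fL1 gL1; apply: (rpredD fL1 gL1). Qed.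

Lemma Lfun1B f g : f \in Lfun P 1 -> g \in Lfun P 1 ->
  (fun w => f w - g w) \in Lfun P 1.
Proof. by move=> fL1 gL1; apply: (rpredB fL1 gL1). Qed.

Lemma Lfun1_ae_le f g : measurable_fun setT f ->
  (\forall w \ae P, `|f w| <= `|g w|) -> g \in Lfun P 1 -> f \in Lfun P 1.
Proof.
move=> mf fg gL1; have mg := Lfun_measurable gL1.
move/Lfun1_integrable/integrableP : gL1 => [_ ig].
apply/Lfun1_integrable/integrableP; split; first exact/measurable_EFinP.
apply: le_lt_trans ig; apply: ae_ge0_le_integral => //.
- by do 2 apply: measurableT_comp => //.
- by do 2 apply: measurableT_comp => //.
- by apply: filterS fg => w /=; rewrite lee_fin.
Qed.

Lemma Lfun1_le f g : measurable_fun setT f ->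
  (forall w, `|f w| <= `|g w|) -> g \in Lfun P 1 -> f \in Lfun P 1.
Proof. by move=> mf fg; apply: Lfun1_ae_le => //; exact: aeW. Qed.

Lemma Lfun1_ae f g : measurable_fun setT f ->
  f = g %[ae P] -> g \in Lfun P 1 -> f \in Lfun P 1.
Proof.
move=> mf fg; apply: Lfun1_ae_le => //.
by apply: filterS fg => w /= /(_ I) ->.
Qed.

(** Serves for functions defined piecewise, on the two sides of an event whose
indicator then need not be mentioned. *)
Lemma Lfun1_ae_or f g h : measurable_fun setT f ->
  (\forall w \ae P, f w = g w \/ f w = h w) ->
  g \in Lfun P 1 -> h \in Lfun P 1 -> f \in Lfun P 1.
Proof.
move=> mf fgh gL1 hL1.
apply: (Lfun1_ae_le mf _ (Lfun1D (Lfun_norm gL1) (Lfun_norm hL1))).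
apply: filterS fgh => w /= fgh.
rewrite [leRHS]ger0_norm ?addr_ge0//=.
by case: fgh => ->; rewrite ?lerDl ?lerDr.
Qed.

Lemma Lfun1_bounded f g (M : R) : measurable_fun setT g ->
  (forall w, `|g w| <= M) -> f \in Lfun P 1 ->
  (fun w => g w * f w) \in Lfun P 1.
Proof.
move=> mg gM fL1; have mf := Lfun_measurable fL1.
have := Lfun_scale M (lexx 1) fL1.
apply: Lfun1_le; first exact: measurable_funM.
move=> w /=; rewrite !normrM mulrC ler_wpM2l//.
by rewrite (le_trans (gM w))// ler_norm.
Qed.

Lemma Lfun1_integrableS (A : set T) f : measurable A -> f \in Lfun P 1 ->
  P.-integrable A (EFin \o f).
Proof.
move=> mA fL1; apply: integrableS measurableT _ _ _ => //.
exact/Lfun1_integrable.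
Qed.

Lemma Lfun1_sub (p : \bar R) : (1 <= p)%E -> {subset Lfun P p <= Lfun P 1}.
Proof.
by move=> p1; apply: Lfun_subset => //; exact: fin_num_measure.
Qed.

End integrability.

(** * Conditionally centered random variables *)

Section centered.
Context {d d' : measure_display} {T : measurableType d} {S : measurableType d'}.
Context {R : realType} (P : probability T R) (W : T -> S).
Hypothesis mW : measurable_fun setT W.

(** The relation E(D | W) = 0, stated through integrals so that it involves no
choice of a version. *)
Definition centered (D : T -> R) :=
  D \in Lfun P 1 /\
  forall B, measurable B -> (\int[P]_(w in W @^-1` B) (D w)%:E = 0)%E.

Lemma centeredB D1 D2 : centered D1 -> centered D2 ->
  centered (fun w => D1 w - D2 w).
Proof.
move=> [L1 D10] [L2 D20]; split; first exact: Lfun1B.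
move=> B mB; have mWB := measurable_preim mW mB.
under eq_integral do rewrite EFinB.
by rewrite integralB ?D10 ?D20 ?sube0//; exact: Lfun1_integrableS.
Qed.

Lemma centeredD D1 D2 : centered D1 -> centered D2 ->
  centered (fun w => D1 w + D2 w).
Proof.
move=> c1 c2; have c0 : centered (cst 0).
  split; first exact: Lfun_cst.
  by move=> B mB; rewrite integral0.
have := centeredB c1 (centeredB c0 c2).
by under eq_fun do rewrite sub0r opprK.
Qed.

Lemma centered_ae D1 D2 : measurable_fun setT D1 -> D1 = D2 %[ae P] ->
  centered D2 -> centered D1.
Proof.
move=> m1 D12 [L2 D20]; split; first exact: Lfun1_ae L2.
move=> B mB; rewrite -(D20 B mB); have mWB := measurable_preim mW mB.
apply: ae_eq_integral => //.
- exact/measurable_EFinP/measurable_funTS.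
- exact/measurable_EFinP/measurable_funTS/(Lfun_measurable L2).
- by apply: filterS D12 => w /= /(_ I) ->.
Qed.

Lemma centered_integral D : centered D -> (\int[P]_w (D w)%:E = 0)%E.
Proof. by case=> _ /(_ setT measurableT); rewrite preimage_setT. Qed.

Import HBSimple HBNNSimple.

Lemma centered_indic D B : centered D -> measurable B ->
  (\int[P]_w (\1_B (W w) * D w)%:E = 0)%E.
Proof.
move=> [_ D0] mB; rewrite -(D0 B mB) [RHS]integral_mkcond.
apply: eq_integral => w _; rewrite patchE.
by rewrite (@indic_mulE _ _ _ (w \in W @^-1` B))//; [case: ifP|rewrite inE].
Qed.

Lemma centered_sfun D (phi : {nnsfun S >-> R}) : centered D ->
  (\int[P]_w (phi (W w) * D w)%:E = 0)%E.
Proof.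
move=> cD; have mD := Lfun_measurable cD.1.
have mphi y : measurable (phi @^-1` [set y]) by exact: measurable_funPTI.
transitivity (\int[P]_w \sum_(y <- finmap.enum_fset (fset_set (range phi)))
    (y%:E * (\1_(phi @^-1` [set y]) (W w) * D w)%:E))%E.
  apply: eq_integral => w _.
  rewrite fimfunE fsbig_finite//= mulr_suml -sumEFin.
  by apply: eq_bigr => y _; rewrite -EFinM mulrA.
have iy y : P.-integrable setT
    (fun w => (\1_(phi @^-1` [set y]) (W w) * D w)%:E).
  apply/Lfun1_integrable; apply: (@Lfun1_bounded _ _ _ _ _ _ 1 _ _ cD.1).
    by apply: measurableT_comp => //; exact: measurable_indic.
  by move=> w; rewrite indicE; case: (_ \in _); rewrite ?normr1 ?normr0.
rewrite integral_sum//; last by move=> y; exact: integrableZl.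
by rewrite big1// => y _; rewrite integralZl// centered_indic// mule0.
Qed.

(** Simple functions increasing to g are dominated by g, so dominated convergence
applies with the dominating function |g(W) D|; g itself may be unbounded. *)
Lemma centered_ge0 D (g : S -> R) : centered D -> measurable_fun setT g ->
  (forall s, 0 <= g s) -> (fun w => g (W w) * D w) \in Lfun P 1 ->
  (\int[P]_w (g (W w) * D w)%:E = 0)%E.
Proof.
move=> cD mg g0 gDL1; have mD := Lfun_measurable cD.1.
have mEg : measurable_fun setT (EFin \o g) by exact/measurable_EFinP.
pose phi := nnsfun_approx measurableT mEg.
have [|||||_ _] := @dominated_convergence _ _ _ P setT measurableT
  (fun n w => (phi n (W w) * D w)%:E) (fun w => (g (W w) * D w)%:E)
  (fun w => `|(g (W w) * D w)%:E|%E).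
- move=> n; apply/measurable_EFinP/measurable_funM => //.
  exact: measurableT_comp.
- exact/measurable_EFinP/measurable_funM/mD/measurableT_comp.
- apply: aeW => w _; under eq_fun do rewrite mulrC EFinM.
  rewrite mulrC EFinM; apply: cvgeZl => //.
  by apply: (cvg_nnsfun_approx measurableT mEg) => // s _; rewrite lee_fin.
- by apply: integrable_abse; exact/Lfun1_integrable.
- apply: aeW => w n _; rewrite !abse_EFin lee_fin !normrM ler_wpM2r//.
  rewrite !ger0_norm// -lee_fin nnsfun_approxE.
  by apply: le_approx => // s _; rewrite lee_fin.
rewrite (_ : [sequence _]_n = cst 0%E); last first.
  by apply/funext => n /=; exact: centered_sfun.
by move=> /cvg_lim <-//; rewrite lim_cst.
Qed.

(** The pull-out rule.  Over an event W in B the factor g becomes 1_B g, whose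
positive and negative parts are handled by the nonnegative case. *)
Lemma centered_mul D (g : S -> R) : centered D -> measurable_fun setT g ->
  (fun w => g (W w) * D w) \in Lfun P 1 ->
  centered (fun w => g (W w) * D w).
Proof.
move=> cD mg gDL1; split=> // B mB.
have mD := Lfun_measurable cD.1.
pose h s := \1_B s * g s.
have mh : measurable_fun setT h by apply: measurable_funM.
have hL1 (k : S -> R) : measurable_fun setT k -> (forall s, `|k s| <= `|g s|) ->
    (fun w => k (W w) * D w) \in Lfun P 1.
  move=> mk kg; apply: Lfun1_le gDL1.
    by apply: measurable_funM => //; exact: measurableT_comp.
  by move=> w; rewrite !normrM ler_wpM2r.
have hg s : `|h s| <= `|g s|.
  rewrite /h (@indic_mulE _ _ _ (s \in B)); last by rewrite inE.
  by case: ifP; rewrite ?normr0.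
have hp : (fun w => h^\+ (W w) * D w) \in Lfun P 1.
  apply: hL1; first exact: measurable_funrpos.
  move=> s; apply: le_trans (hg s).
  by rewrite ger0_norm ?funrpos_ge0// /funrpos ge_max ler_norm normr_ge0.
have hn : (fun w => h^\- (W w) * D w) \in Lfun P 1.
  apply: hL1; first exact: measurable_funrneg.
  move=> s; apply: le_trans (hg s).
  by rewrite ger0_norm ?funrneg_ge0// /funrneg ge_max -normrN ler_norm normr_ge0.
transitivity (\int[P]_w ((h^\+ (W w) * D w)%:E - (h^\- (W w) * D w)%:E))%E.
  rewrite integral_mkcond; apply: eq_integral => w _.
  rewrite -EFinB -mulrBl.
  have -> : h^\+ (W w) - h^\- (W w) = h (W w).
    by rewrite -[in RHS](funrposBneg h).
  rewrite patchE /h -mulrA.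
  by rewrite (@indic_mulE _ _ _ (w \in W @^-1` B))//; [case: ifP|rewrite inE].
rewrite integralB//; [|exact/Lfun1_integrable..].
rewrite !centered_ge0 ?sube0//.
- exact: measurable_funrneg.
- exact: measurable_funrpos.
Qed.

(** Multiply h(W) by its own sign: the integral of |h(W)| is zero. *)
Lemma centered_eq0 (h : S -> R) : measurable_fun setT h ->
  centered (h \o W) -> h \o W = cst 0 %[ae P].
Proof.
move=> mh ch; pose s (x : S) := Num.sg (h x).
have ms : measurable_fun setT s by apply: measurableT_comp => //; exact: measurable_sgr.
have shE : (fun w => s (W w) * (h \o W) w) = Num.norm \o (h \o W).
  by apply/funext => w /=; rewrite /s -normrEsg.
have : centered (fun w => s (W w) * (h \o W) w).
  by apply: centered_mul => //; rewrite shE Lfun_norm// ch.1.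
rewrite shE => /centered_integral h0.
have mhW : measurable_fun setT (EFin \o (h \o W)).
  by apply/measurable_EFinP/measurableT_comp.
have /(ae_eq_integral_abs P measurableT mhW) : (\int[P]_w `|(EFin \o (h \o W)) w| = 0)%E.
  exact: h0.
by apply: filterS => w /= /(_ I)[].
Qed.

End centered.

(** The tower property: sigma(k(W)) is contained in sigma(W).  It is applied to
W = (X, Z) and k the second projection. *)
Lemma centered_comp {d d' d'' : measure_display} {T : measurableType d}
    {S : measurableType d'} {S' : measurableType d''} {R : realType}
    (P : probability T R) (W : T -> S) (k : S -> S') (D : T -> R) :
  measurable_fun setT k -> centered P W D -> centered P (k \o W) D.
Proof.
move=> mk [DL1 D0]; split => // B mB; rewrite comp_preimage; apply: D0.
exact: measurable_preim.
Qed.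

(** * Conditional expectations as functions of the conditioning variable *)

(** Each event V < q with q rational is of the form W in B_q.  The function
sending s to the infimum of the rationals q with s in B_q is measurable on the
whole of S, and at s = W w it is the infimum of the rationals above V w. *)
Lemma doob_dynkin {d d' : measure_display} {T : measurableType d}
    {S : measurableType d'} {R : realType} (W : T -> S) (V : T -> R) :
  measurable_fun [set: g_sigma_algebra_preimageType W]
    (V : g_sigma_algebra_preimageType W -> R) ->
  exists2 v : S -> R, measurable_fun setT v & V = v \o W.
Proof.
move=> mV.
have /choice[B BP] (q : rat) : exists B : set S,
    measurable B /\ W @^-1` B = V @^-1` `]-oo, ratr q[.
  have [B mB] := mV measurableT _ (measurable_itv `]-oo, ratr q : R[).
  by rewrite !setTI => BE; exists B.
have WB w q : (W w \in B q) = (V w < ratr q).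
  have [_ /seteqP[s1 s2]] := BP q.
  by apply/idP/idP => [/set_mem/s1|Vq]; rewrite /= ?in_itv//=;
    apply/mem_set/s2; rewrite /= in_itv.
(* the candidates q are enumerated by [unpickle], with the neutral value
   +oo for the numbers that encode no rational *)
pose f n s : \bar R :=
  (if (unpickle n : option rat) is Some q then
    if s \in B q then (ratr q)%:E else +oo else +oo)%E.
have mf n : measurable_fun setT (f n).
  rewrite /f; case: unpickle => [q|//].
  apply: measurable_fun_ifT => //; apply: (measurable_fun_bool true).
  by rewrite setTI preimage_mem_true; exact: (BP q).1.
pose h s := einfs (f ^~ s) 0%N.
have hE w : h (W w) = (V w)%:E.
  apply/eqP; rewrite eq_le; apply/andP; split.
    apply/lee_addgt0Pr => e e0.
    have /rat_in_itvoo[q] : V w < V w + e by rewrite ltrDl.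
    rewrite in_itv/= => /andP[Vq qV].
    apply: (@le_trans _ _ (ratr q)%:E); last by rewrite -EFinD lee_fin ltW.
    apply: ereal_inf_lbound; exists (pickle q) => //=.
    by rewrite /f pickleK WB Vq.
  apply: le_ereal_inf_tmp => _ [n _ <-]; rewrite /f.
  case: unpickle => [q|]; rewrite ?leey// WB.
  by case: ifPn => [/ltW|]; rewrite ?leey.
exists (fine \o h); last by apply/funext => w /=; rewrite hE.
by apply: measurableT_comp => //; exact: measurable_fun_einfs.
Qed.

Section condexp.
Context {d d' : measure_display} {T : measurableType d} {S : measurableType d'}.
Context {R : realType} (P : probability T R) (W : T -> S).
Hypothesis mW : measurable_fun setT W.

(** This holds for every U, because the default value of [condexp] is a constant
and hence is also a function of W. *)
Lemma condexp_factor (U : T -> R) :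
  exists2 v : S -> R, measurable_fun setT v & condexp P W U = v \o W.
Proof.
rewrite /condexp; case: xgetP => [V _ [mV _ _]|_]; first exact: doob_dynkin.
by exists (cst 0).
Qed.

Lemma condexp_spec (U : T -> R) : U \in Lfun P 1 ->
  exists v : S -> R, [/\ measurable_fun setT v, condexp P W U = v \o W &
    centered P W (fun w => U w - v (W w))].
Proof.
move=> UL1; have [mV iV VU] := condexpP mW UL1.
have [v mv vE] := condexp_factor U; exists v; split => //.
rewrite {}vE in mV iV VU; move/Lfun1_integrable in iV.
split; first exact: Lfun1B iV.
move=> B mB; have mWB := measurable_preim mW mB.
under eq_integral do rewrite EFinB.
rewrite integralB; [|by []|exact: Lfun1_integrableS..].
rewrite VU ?subee//; last by exists B => //; rewrite setTI.
by apply: integrable_fin_num => //; exact: Lfun1_integrableS.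
Qed.

Lemma version_Lfun1 (U : T -> R) (v : S -> R) : U \in Lfun P 1 ->
  centered P W (fun w => U w - v (W w)) -> (v \o W) \in Lfun P 1.
Proof.
move=> UL1 cv; have := Lfun1B UL1 cv.1.
by under eq_fun do rewrite opprB addrC subrK.
Qed.

(** The difference of two versions is a centered function of W. *)
Lemma condexp_unique (U : T -> R) (v : S -> R) : U \in Lfun P 1 ->
  measurable_fun setT v -> centered P W (fun w => U w - v (W w)) ->
  condexp P W U = v \o W %[ae P].
Proof.
move=> UL1 mv cv; have [u [mu -> cu]] := condexp_spec UL1.
have : centered P W ((fun s => u s - v s) \o W).
  have := centeredB mW cv cu.
  by congr centered; apply/funext => w /=; lra.
move=> /centered_eq0 /=; move=> /(_ mW (measurable_funB mu mv)).
by apply: filterS => w /= /(_ I)/eqP; rewrite subr_eq0 => /eqP.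
Qed.

End condexp.

(** * Integrability of conditional expectations *)

Section truncation.
Context {d : measure_display} {T : measurableType d} {R : realType}.
Variable P : probability T R.

(** Monotone convergence along the events |h| <= n, which increase to the whole
space.  It allows test functions to be truncated where only bounded ones are
known to be admissible. *)
Lemma Lfun1_truncation (f h : T -> R) (C : R) :
  measurable_fun setT f -> measurable_fun setT h -> (forall w, 0 <= f w) ->
  (forall n : nat,
    \int[P]_w (\1_[set w | `|h w| <= n%:R] w * f w)%:E <= C%:E)%E ->
  f \in Lfun P 1.
Proof.
move=> mf mh f0 fC; apply/Lfun1_integrable/integrableP.
split; first exact/measurable_EFinP.
pose g n w := (\1_[set w | `|h w| <= n%:R] w * f w)%:E.
have gE n w : g n w = if `|h w| <= n%:R then (f w)%:E else 0%E.
  by rewrite /g (@indic_mulE _ _ _ (`|h w| <= n%:R))//; case: ifP.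
have mg n : measurable_fun setT (g n).
  apply/measurable_EFinP/measurable_funM => //.
  by apply: measurable_indic; exact: measurable_abs_le.
have gg n m : (n <= m)%N -> forall w, (g n w <= g m w)%E.
  move=> nm w; rewrite !gE; case: ifPn => [hn|_].
    by rewrite (le_trans hn) ?ler_nat.
  by case: ifPn => //; rewrite lee_fin.
have g0 n w : (0 <= g n w)%E by rewrite gE; case: ifPn; rewrite // lee_fin.
have glim w : limn (g ^~ w) = (f w)%:E.
  apply/cvg_lim => //; apply: cvg_near_cst.
  exists (Num.truncn `|h w|).+1 => // n /= hn; rewrite gE ifT//.
  by rewrite (le_trans (ltW (truncnS_gt _)))// ler_nat.
have cvgg := @cvg_monotone_convergence _ _ _ P _ measurableT g mg (fun n w _ => g0 n w)
  (fun w _ n m nm => gg n m nm w).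
under eq_integral do rewrite abse_EFin ger0_norm//.
apply: (@le_lt_trans _ _ C%:E); last exact: ltry.
under eq_integral do rewrite -glim.
rewrite -(cvg_lim _ cvgg)//; apply: lime_le; first exact: cvgP cvgg.
exact: nearW.
Qed.

End truncation.

Section condexp_integrability.
Context {d d' : measure_display} {T : measurableType d} {S : measurableType d'}.
Context {R : realType} (P : probability T R) (W : T -> S).
Hypothesis mW : measurable_fun setT W.
Variables (U : T -> R) (v : S -> R).
Hypotheses (UL1 : U \in Lfun P 1) (mv : measurable_fun setT v).
Hypothesis cUv : centered P W (fun w => U w - v (W w)).

Let mvW : measurable_fun setT (v \o W).
Proof. exact: measurableT_comp. Qed.

Let vL1 : (v \o W) \in Lfun P 1.
Proof. exact: (version_Lfun1 UL1 cUv). Qed.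

Lemma condexp_bounded_integral (g : S -> R) (M : R) : measurable_fun setT g ->
  (forall s, `|g s| <= M) ->
  (\int[P]_w (g (W w) * v (W w))%:E = \int[P]_w (g (W w) * U w)%:E)%E.
Proof.
move=> mg gM; have mgW : measurable_fun setT (g \o W) by exact: measurableT_comp.
have gL1 f : f \in Lfun P 1 -> (fun w => g (W w) * f w) \in Lfun P 1.
  by apply: Lfun1_bounded => // w; exact: gM.
have /centered_integral := centered_mul mW cUv mg (gL1 _ cUv.1).
under eq_integral do rewrite mulrBr EFinB.
rewrite integralB//; [|exact/Lfun1_integrable/gL1..].
have fin f : f \in Lfun P 1 -> (\int[P]_w (g (W w) * f w)%:E)%E \is a fin_num.
  by move=> /gL1/Lfun1_integrable; exact: integrable_fin_num.
rewrite -(fineK (fin _ UL1)) -(fineK (fin _ vL1)) -EFinB => /eqP.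
by rewrite eqe subr_eq0 => /eqP ->.
Qed.

(** Testing U against sg(v) |g| truncated at |g| <= n bounds the integral of
|g(W) v(W)| over that event by the integral of |g(W) U|, uniformly in n. *)
Lemma condexp_mul_Lfun1 (g : S -> R) : measurable_fun setT g ->
  (fun w => g (W w) * U w) \in Lfun P 1 ->
  (fun w => g (W w) * v (W w)) \in Lfun P 1.
Proof.
move=> mg gUL1; have mgW : measurable_fun setT (g \o W) by exact: measurableT_comp.
have mU := Lfun_measurable UL1.
apply: (@Lfun1_le _ _ _ _ _ (fun w => `|g (W w) * v (W w)|)).
- exact: measurable_funM.
- by move=> w; rewrite normr_id.
have igU : P.-integrable setT (fun w => `|g (W w) * U w|%:E).
  exact/Lfun1_integrable/Lfun_norm.
apply: (@Lfun1_truncation _ _ _ _ _ (g \o W)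
  (fine (\int[P]_w `|g (W w) * U w|%:E)%E)) => //.
- by apply: measurableT_comp => //; exact: measurable_funM.
move=> n; rewrite fineK; last exact: integrable_fin_num.
pose s x := \1_[set x | `|g x| <= n%:R] x * (`|g x| * Num.sg (v x)).
have ms : measurable_fun setT s.
  apply: measurable_funM.
    by apply: measurable_indic; exact: measurable_abs_le.
  apply: measurable_funM; first exact: measurableT_comp.
  by apply: measurableT_comp => //; exact: measurable_sgr.
have sE x : s x = if `|g x| <= n%:R then `|g x| * Num.sg (v x) else 0.
  by rewrite /s (@indic_mulE _ _ _ (`|g x| <= n%:R)).
have sg x : `|s x| <= `|g x|.
  rewrite sE; case: ifPn => _; last by rewrite normr0.
  by rewrite normrM normr_id ler_piMr ?normr_sg_le1.
have sn x : `|s x| <= n%:R.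
  have [gn|gn] := leP (`|g x|) n%:R; first exact: le_trans (sg x) gn.
  by rewrite sE (lt_geF gn) normr0.
have sUL1 : (fun w => s (W w) * U w) \in Lfun P 1.
  apply: (@Lfun1_bounded _ _ _ _ U (s \o W) n%:R) => // [|w]; last exact: sn.
  exact: measurableT_comp.
rewrite (_ : integral _ _ _ = \int[P]_w (s (W w) * v (W w))%:E)%E; last first.
  apply: eq_integral => w _; rewrite /s -!mulrA; congr (_ * _)%:E.
  by rewrite normrM [in LHS](normrEsg (v _)).
rewrite (condexp_bounded_integral ms sn); apply: le_integral => //.
- exact/Lfun1_integrable.
- move=> w _; rewrite lee_fin (le_trans (ler_norm _))// normrM [leRHS]normrM.
  by rewrite ler_wpM2r.
Qed.

(** Test U against sg(v) |v|^(r-1) truncated at |v| <= n, and let I_n be the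
integral of |v(W)|^r over that event.  Young's inequality yields
I_n <= (1/r) E|U|^r + (1/q) I_n, and I_n is finite, so that I_n <= E|U|^r. *)
Let condexp_powR (r : R) : 1 < r -> U \in Lfun P r%:E ->
  (fun w => `|v (W w)| `^ r) \in Lfun P 1.
Proof.
move=> r1 ULr; have r0 : 0 < r by exact: lt_trans r1.
pose q := r / (r - 1).
have r10 : 0 < r - 1 by rewrite subr_gt0.
have q0 : 0 < q by rewrite divr_gt0.
have rq : r^-1 + q^-1 = 1.
  by rewrite /q invf_div -{1}(div1r r) -mulrDl subrKC mulfV// gt_eqF.
have UrL1 : (fun w => `|U w| `^ r) \in Lfun P 1.
  by apply/Lfun1_integrable; apply: Lfun_integrable => //; exact: ltW.
have mpow (k : R) : measurable_fun setT (fun s => `|v s| `^ k).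
  apply: (measurableT_comp (measurable_powR k)) => //.
  exact: measurableT_comp.
apply: (@Lfun1_truncation _ _ _ _ _ (v \o W) (\int[P]_w (`|U w| `^ r))) => //.
  by apply: (measurableT_comp (mpow r)) => //.
move=> n; pose A := [set s | `|v s| <= n%:R].
have mA : measurable A by exact: measurable_abs_le.
pose g s := \1_A s * (Num.sg (v s) * `|v s| `^ (r - 1)).
have mg : measurable_fun setT g.
  apply: measurable_funM; first exact: measurable_indic.
  apply: measurable_funM => //.
  by apply: measurableT_comp => //; exact: measurable_sgr.
have gA s : g s = if `|v s| <= n%:R then Num.sg (v s) * `|v s| `^ (r - 1) else 0.
  by rewrite /g (@indic_mulE _ _ _ (`|v s| <= n%:R)).
have gn s : `|g s| <= n%:R `^ (r - 1).
  rewrite gA; case: ifPn => [vn|_]; last by rewrite normr0 powR_ge0.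
  rewrite normrM (ger0_norm (powR_ge0 _ _)).
  apply: (@le_trans _ _ (`|v s| `^ (r - 1))).
    by rewrite ler_piMl ?powR_ge0 ?normr_sg_le1.
  by rewrite ge0_ler_powR ?nnegrE// ltW.
have gvE w : \1_[set w | `|(v \o W) w| <= n%:R] w * `|v (W w)| `^ r =
    g (W w) * v (W w).
  rewrite /g -mulrA; congr (_ * _).
  by rewrite mulrAC -normrEsg mulr_powRB1.
have gfL1 f : f \in Lfun P 1 -> (fun w => g (W w) * f w) \in Lfun P 1.
  move=> fL1; apply: (@Lfun1_bounded _ _ _ _ f (g \o W) (n%:R `^ (r - 1))) => //.
  - exact: measurableT_comp.
  - by move=> w; exact: gn.
have iU := UrL1; move/Lfun1_integrable in iU.
have iv := gfL1 _ vL1; move/Lfun1_integrable in iv.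
have igU := gfL1 _ UL1; move/Lfun1_integrable in igU.
under eq_integral do rewrite gvE.
pose I := \int[P]_w (g (W w) * v (W w)).
rewrite -(fineK (integrable_fin_num measurableT iv)) lee_fin -/I.
(* the step that uses Young's inequality: the integral I is first rewritten
   as the integral of g(W) U *)
have : I <= \int[P]_w (`|U w| `^ r / r + g (W w) * v (W w) / q).
  rewrite /I /Rintegral (condexp_bounded_integral mg gn).
  apply: le_Rintegral => //.
    apply/Lfun1_integrable/Lfun1D; apply/Lfun1_integrable.
      exact: (integrableZr measurableT r^-1 iU).
    exact: (integrableZr measurableT q^-1 iv).
  move=> w _; rewrite -gvE (le_trans (ler_norm _))// normrM mulrC.
  apply: (le_trans (conjugate_powR _ _ r0 q0 rq)) => //.
  rewrite lerD2l ler_wpM2r ?invr_ge0 ?(ltW q0)//.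
  rewrite gA (@indic_mulE _ _ _ (`|v (W w)| <= n%:R))//; case: ifPn => _.
    rewrite normrM normr_sg (ger0_norm (powR_ge0 _ _)) powRM ?powR_ge0//.
    rewrite -powRrM (_ : (r - 1) * q = r); last first.
      by rewrite /q mulrC divfK// gt_eqF.
    rewrite ler_piMl ?powR_ge0//.
    by case: (_ != 0); rewrite ?powR1// powR0// gt_eqF.
  by rewrite normr0 powR0// gt_eqF.
rewrite RintegralD//; last 2 first.
- exact: (integrableZr measurableT r^-1 iU).
- exact: (integrableZr measurableT q^-1 iv).
rewrite !RintegralZr// -/I -lerBlDr -{1}(mulr1 I) -mulrBr.
have -> : 1 - q^-1 = r^-1 by rewrite -rq addrK.
by rewrite ler_pM2r ?invr_gt0.
Qed.

(** Let M bound |U| almost surely.  Testing U - v(W) against the sign of v(W) on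
the event |v(W)| > M gives a variable which is negative on that event and has
integral zero. *)
Let condexp_bounded : U \in Lfun P +oo%E ->
  exists M : R, \forall w \ae P, `|v (W w)| <= M.
Proof.
rewrite inE => /andP[_]; rewrite inE/= /finite_norm unlock.
have -> : (0 < P setT)%E by rewrite probability_setT lte01.
move=> /(@ess_supr_bounded _ _ _ P (Num.norm \o U))[M UM]; exists M.
pose B := [set s | M < `|v s|].
have mB : measurable B.
  rewrite (_ : B = ~` [set s | `|v s| <= M]).
    by apply: measurableC; exact: measurable_abs_le.
  by apply/seteqP; split=> s; rewrite /B /= ltNge => /negP.
pose g s := \1_B s * Num.sg (v s).
have gE s : g s = if M < `|v s| then Num.sg (v s) else 0.
  by rewrite /g (@indic_mulE _ _ _ (M < `|v s|)).
have mg : measurable_fun setT g.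
  apply: measurable_funM; first exact: measurable_indic.
  by apply: measurableT_comp => //; exact: measurable_sgr.
have g1 s : `|g s| <= 1.
  rewrite gE; case: ifPn => _; last by rewrite normr0.
  exact: normr_sg_le1.
pose D w := g (W w) * (U w - v (W w)).
have cD : centered P W D.
  apply: centered_mul => //.
  apply: (@Lfun1_bounded _ _ _ _ _ (g \o W) 1 _ _ cUv.1) => [|w].
    exact: measurableT_comp.
  exact: g1.
have D0 : \forall w \ae P, (M < `|v (W w)| -> D w < 0) /\
    `|(D w)%:E|%E = ((-1)%:E * (D w)%:E)%E.
  apply: filterS UM => w /= UM; rewrite /D gE; case: ltP => vM; last first.
    by rewrite mul0r normr0 mule0.
  have Dlt0 : Num.sg (v (W w)) * (U w - v (W w)) < 0.
    rewrite mulrBr -normrEsg subr_lt0; apply: le_lt_trans vM.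
    apply: le_trans UM; rewrite (le_trans (ler_norm _))// normrM.
    by rewrite ler_piMl// normr_sg_le1.
  by split => //; rewrite -EFinM mulN1r ltr0_norm.
have mD : measurable_fun setT (EFin \o D).
  by apply/measurable_EFinP; exact: Lfun_measurable cD.1.
have : (\int[P]_w `|(D w)%:E| = 0)%E.
  transitivity (\int[P]_w ((-1)%:E * (D w)%:E))%E.
    apply: ae_eq_integral => //.
    - exact: measurableT_comp.
    - exact: measurable_funeM.
    - by apply: filterS D0 => w [].
  rewrite integralZl ?(centered_integral cD) ?mule0//.
  exact/Lfun1_integrable/cD.1.
move=> /(ae_eq_integral_abs P measurableT mD); apply: filterS2 D0.
move=> w [vM _] /(_ I)[Dw0]; rewrite leNgt; apply/negP => /vM.
by rewrite Dw0 ltxx.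
Qed.

(** Conditional Jensen inequality, in its qualitative form. *)
Lemma condexp_Lfun (p : \bar R) : (1 <= p)%E -> U \in Lfun P p ->
  (v \o W) \in Lfun P p.
Proof.
move=> p1 ULp; have mU := Lfun_measurable UL1.
rewrite inE; apply/andP; split; rewrite inE//=.
case: p p1 ULp => [r||//]; rewrite ?lee_fin => r1 ULp.
  have [->|r_neq1] := eqVneq r 1.
    by have := vL1; rewrite inE => /andP[_]; rewrite inE.
  have {r_neq1} r_gt1 : 1 < r by rewrite lt_neqAle eq_sym r_neq1.
  have /Lfun1_integrable/integrableP[_] := condexp_powR r_gt1 ULp.
  rewrite /finite_norm unlock => h; rewrite poweR_lty//; apply: le_lt_trans h.
  by under [leRHS]eq_integral do rewrite abse_EFin ger0_norm ?powR_ge0//.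
have [M vM] := condexp_bounded ULp.
rewrite /finite_norm unlock; case: ifPn => _; last exact: ltry.
by apply: (@le_lt_trans _ _ M%:E); [exact/ess_supP|exact: ltry].
Qed.

End condexp_integrability.

(** * Conjugate exponents *)

Section conjugate_exponents.
Context {R : realType}.

Lemma conjugate_exponentsP (p q : \bar R) : (1 <= p)%E -> (1 <= q)%E ->
  (p^-1 + q^-1 = 1)%E ->
  [\/ p = +oo%E /\ q = 1%E, p = 1%E /\ q = +oo%E |
      exists r s : R, [/\ p = r%:E, q = s%:E, 0 < r, 0 < s & r^-1 + s^-1 = 1]].
Proof.
case: p q => [r||//] [s||//]; rewrite ?lee_fin => r1 s1.
- have r0 : 0 < r by exact: lt_le_trans r1.
  have s0 : 0 < s by exact: lt_le_trans s1.
  rewrite !inver !gt_eqF// -EFinD => -[rs]; apply: Or33.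
  by exists r, s.
- rewrite invey adde0 => /eqP; rewrite inve_eq1 => /eqP ->.
  exact: Or32.
- rewrite invey add0e => /eqP; rewrite inve_eq1 => /eqP ->.
  exact: Or31.
- by rewrite invey adde0 => /eqP; rewrite eqe eq_sym oner_eq0.
Qed.

(** The reciprocals 1/p and 1/q add up to 1, so one of them is at most 1/2 and
one is at least 1/2. *)
Lemma conjugate_exponents_2 (p q : \bar R) : (1 <= p)%E -> (1 <= q)%E ->
  (p^-1 + q^-1 = 1)%E -> (2%:E <= maxe p q)%E /\ (mine p q <= 2%:E)%E.
Proof.
move=> p1 q1 /(conjugate_exponentsP p1 q1)[[-> ->]|[-> ->]|].
- by rewrite le_max leey ge_min lee1n orbT.
- by rewrite le_max leey orbT ge_min lee1n.
move=> [r [s [-> -> r0 s0 rs]]]; rewrite le_max ge_min !lee_fin.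
have half (t : R) : 0 < t -> (2 <= t) = (t^-1 <= 2^-1).
  by move=> t0; rewrite lef_pV2 ?posrE.
have half' (t : R) : 0 < t -> (t <= 2) = (2^-1 <= t^-1).
  by move=> t0; rewrite lef_pV2 ?posrE.
rewrite !half// !half'//.
split; apply/orP; have [h|h] := leP r^-1 2^-1.
- by left.
- by right; lra.
- by right; lra.
- by left; lra.
Qed.

Lemma Lfun_mul_conjugate {d : measure_display} {T : measurableType d}
    (P : probability T R) (p q : \bar R) (f g : T -> R) :
  (1 <= p)%E -> (1 <= q)%E -> (p^-1 + q^-1 = 1)%E ->
  f \in Lfun P p -> g \in Lfun P q -> (fun w => f w * g w) \in Lfun P 1.
Proof.
move=> p1 q1 pq fp gq.
have bounded_mul (a b : T -> R) : a \in Lfun P +oo%E -> b \in Lfun P 1 ->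
    (fun w => a w * b w) \in Lfun P 1.
  move=> aLy bL1; have ma := Lfun_measurable aLy; have mb := Lfun_measurable bL1.
  move: aLy; rewrite inE => /andP[_]; rewrite inE/= /finite_norm unlock.
  have -> : (0 < P setT)%E by rewrite probability_setT lte01.
  move=> /(@ess_supr_bounded _ _ _ P (Num.norm \o a))[M aM].
  apply: Lfun1_ae_le (Lfun_scale M (lexx 1) bL1); first exact: measurable_funM.
  apply: filterS aM => w /= aM; rewrite !normrM mulrC ler_wpM2l//.
  by rewrite (le_trans aM)// ler_norm.
move: (conjugate_exponentsP p1 q1 pq) fp gq => [[-> ->]|[-> ->]|].
- exact: bounded_mul.
- by move=> f1 gy; under eq_fun do rewrite mulrC; exact: bounded_mul.
move=> [r [s [-> -> r0 s0 rs]]] fr gs.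
have mf := Lfun_measurable fr; have mg := Lfun_measurable gs.
rewrite inE; apply/andP; split; rewrite inE/=; first exact: measurable_funM.
rewrite /finite_norm (le_lt_trans (hoelder P mf mg r0 s0 rs))//.
move: fr gs; rewrite !inE => /andP[_] + /andP[_]; rewrite !inE/= => fr gs.
by rewrite lte_mul_pinfty// ?ge0_fin_numE ?Lnorm_ge0.
Qed.

End conjugate_exponents.

(** * Affine conditional expectations *)

Section conditional_regression.
Context {d d' : measure_display} {T : measurableType d} {S : measurableType d'}.
Context {R : realType} (P : probability T R) (Z : T -> S).
Hypothesis mZ : measurable_fun setT Z.
Variables (p q : \bar R) (X Y : T -> R).
Hypotheses (p1 : (1 <= p)%E) (q1 : (1 <= q)%E) (pq : (p^-1 + q^-1 = 1)%E).
Hypotheses (XLp : X \in Lfun P p) (YLq : Y \in Lfun P q).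

Let XZ w := (X w, Z w).

Let mX : measurable_fun setT X. Proof. exact: Lfun_measurable XLp. Qed.
Let mY : measurable_fun setT Y. Proof. exact: Lfun_measurable YLq. Qed.

Let mXZ : measurable_fun setT XZ. Proof. exact: measurable_fun_pair. Qed.

Let XL1 : X \in Lfun P 1. Proof. exact: Lfun1_sub XLp. Qed.
Let YL1 : Y \in Lfun P 1. Proof. exact: Lfun1_sub YLq. Qed.

Let mulL1 f g : f \in Lfun P p -> g \in Lfun P q ->
  (fun w => f w * g w) \in Lfun P 1.
Proof. exact: Lfun_mul_conjugate. Qed.

Let centered_XZ D : centered P XZ D -> centered P Z D.
Proof. exact: (centered_comp measurable_snd). Qed.

(** Here r will be p, q or 2. *)
Let residual_Lfun r U (u : S -> R) : (1 <= r)%E -> U \in Lfun P r ->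
  measurable_fun setT u -> centered P Z (fun w => U w - u (Z w)) ->
  (fun w => U w - u (Z w)) \in Lfun P r.
Proof.
move=> r1 ULr mu cu; have UL1 : U \in Lfun P 1 by exact: Lfun1_sub ULr.
have uLr := condexp_Lfun mZ UL1 mu cu r1 ULr.
exact: ((Lfun_addr_closed P r1).2 _ _ ULr (Lfun_oppr_closed uLr)).
Qed.

(** Y - y(Z) is centered given (X, Z), and X - x(Z) is a function of (X, Z). *)
Lemma condcov_condexp_eq : condexp P XZ Y = condexp P Z Y %[ae P] ->
  condcov P Z X Y = (fun=> 0) %[ae P] /\
  exists a b : S -> R, affine_condexp P Z X Y a b.
Proof.
have [x [mx xE cx]] := condexp_spec mZ XL1.
have [y [my yE cy]] := condexp_spec mZ YL1.
have [e [me eE ce]] := condexp_spec mXZ YL1.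
have yLq := condexp_Lfun mZ YL1 my cy q1 YLq.
move=> eyae; have ey : \forall w \ae P, e (XZ w) = y (Z w).
  by apply: filterS eyae => w /= /(_ I); rewrite eE yE.
split; last first.
  exists y, (cst 0); split => //.
  - exact: Lfun1_sub yLq.
  - by under eq_fun do rewrite mulrC; exact: mulL1.
  - by apply: filterS ey => w /= ey _; rewrite -/XZ eE/= ey mul0r addr0.
have covE : condcov P Z X Y =
    condexp P Z (fun w => (X w - x (Z w)) * (Y w - y (Z w))).
  by rewrite /condcov xE yE.
have mdx : measurable_fun setT (fun s : R * S => s.1 - x s.2).
  apply: measurable_funB => //; exact: measurableT_comp.
have myZ : measurable_fun setT (y \o Z) by exact: measurableT_comp.
have cXZ : centered P XZ (fun w => Y w - y (Z w)).
  apply: (centered_ae mXZ _ _ ce); first exact: measurable_funB.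
  by apply: filterS ey => w /= ->.
have dL1 : (fun w => (X w - x (Z w)) * (Y w - y (Z w))) \in Lfun P 1.
  by apply: mulL1; exact: residual_Lfun.
suff : condcov P Z X Y = cst 0 \o Z %[ae P].
  by apply: filterS => w ->.
rewrite covE; apply: (condexp_unique (v := cst 0) mZ dL1) => //.
under eq_fun do rewrite subr0.
exact/centered_XZ/(centered_mul mXZ cXZ mdx).
Qed.

Hypothesis p2 : (2%:E <= p)%E.

Let XL2 : X \in Lfun P 2%:E.
Proof. by apply: Lfun_subset XLp => //; [rewrite lee1n|exact: fin_num_measure]. Qed.

(** All that the affine representation says about a and b.  The second identity
leaves b(Z) undetermined where the conditional variance vanishes; the third
one states that X is a function of Z there, so that this does not matter. *)
Lemma affine_condexp_coefficients (a b : S -> R) : affine_condexp P Z X Y a b ->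
  [/\ \forall w \ae P, condexp P Z Y w = a (Z w) + b (Z w) * condexp P Z X w,
      \forall w \ae P, condcov P Z X Y w = b (Z w) * condvar P Z X w &
      \forall w \ae P, condvar P Z X w <= 0 -> X w = condexp P Z X w].
Proof.
move=> [ma mb aL1 aXL1]; rewrite -/XZ.
have [x [mx xE cx]] := condexp_spec mZ XL1.
have [y [my yE cy]] := condexp_spec mZ YL1.
have [e [me eE ce]] := condexp_spec mXZ YL1.
move=> eabae; have eab : \forall w \ae P, e (XZ w) = a (Z w) + b (Z w) * X w.
  by apply: filterS eabae => w /= /(_ I); rewrite eE.
have maZ : measurable_fun setT (a \o Z) by exact: measurableT_comp.
have mbZ : measurable_fun setT (b \o Z) by exact: measurableT_comp.
have mxZ : measurable_fun setT (x \o Z) by exact: measurableT_comp.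
have myZ : measurable_fun setT (y \o Z) by exact: measurableT_comp.
have meXZ : measurable_fun setT (e \o XZ) by exact: measurableT_comp.
have eL1 : (e \o XZ) \in Lfun P 1.
  exact: (version_Lfun1 YL1 ce).
have cYab : centered P XZ (fun w => Y w - (a (Z w) + b (Z w) * X w)).
  apply: (centered_ae mXZ _ _ ce).
    apply: measurable_funB => //; apply: measurable_funD => //.
    exact: measurable_funM.
  by apply: filterS eab => w /= ->.
have bXL1 : (fun w => b (Z w) * X w) \in Lfun P 1.
  apply: Lfun1_ae (Lfun1B eL1 aL1); first exact: measurable_funM.
  by apply: filterS eab => w /= -> _; rewrite addrC addKr.
have bxL1 : (fun w => b (Z w) * x (Z w)) \in Lfun P 1.
  exact: (condexp_mul_Lfun1 mZ XL1 mx cx mb bXL1).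
have cbX : centered P Z (fun w => b (Z w) * (X w - x (Z w))).
  apply: (centered_mul mZ cx mb).
  by have := Lfun1B bXL1 bxL1; under eq_fun do rewrite -mulrBr.
have yab : \forall w \ae P, y (Z w) = a (Z w) + b (Z w) * x (Z w).
  suff : condexp P Z Y = (fun s => a s + b s * x s) \o Z %[ae P].
    by apply: filterS => w /= /(_ I); rewrite yE.
  apply: (condexp_unique mZ YL1).
    by apply: measurable_funD => //; exact: measurable_funM.
  have := centeredD mZ (centered_XZ cYab) cbX.
  by congr centered; apply/funext => w /=; ring.
have yLq := condexp_Lfun mZ YL1 my cy q1 YLq.
have xL2 := condexp_Lfun mZ XL1 mx cx (lee1n 2) XL2.
have dXLp : (fun w => X w - x (Z w)) \in Lfun P p by exact: residual_Lfun.
have dXL2 : (fun w => X w - x (Z w)) \in Lfun P 2%:E.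
  by apply: residual_Lfun => //; rewrite lee1n.
have dYLq : (fun w => Y w - y (Z w)) \in Lfun P q by exact: residual_Lfun.
have dXYL1 : (fun w => (X w - x (Z w)) * (Y w - y (Z w))) \in Lfun P 1.
  exact: mulL1.
have dX2L1 : (fun w => (X w - x (Z w)) ^+ 2) \in Lfun P 1.
  by apply/Lfun1_integrable; exact: Lfun2_integrable_sqr.
have [c [mc cE cc]] := condexp_spec mZ dX2L1.
have varE : condvar P Z X = c \o Z by rewrite /condvar xE.
split.
- by apply: filterS yab => w; rewrite xE yE.
- have covE : condcov P Z X Y =
      condexp P Z (fun w => (X w - x (Z w)) * (Y w - y (Z w))).
    by rewrite /condcov xE yE.
  have mdx : measurable_fun setT (fun s : R * S => s.1 - x s.2).
    by apply: measurable_funB => //; exact: measurableT_comp.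
  (* b(Z) (X - x(Z))^2 is integrable because it is the difference of
     (X - x(Z)) e(X, Z) and (X - x(Z)) y(Z); each of these is integrable *)
  have dXeL1 : (fun w => (X w - x (Z w)) * e (XZ w)) \in Lfun P 1.
    exact: (condexp_mul_Lfun1 mXZ YL1 me ce mdx (mulL1 dXLp YLq)).
  have bdX2L1 : (fun w => b (Z w) * (X w - x (Z w)) ^+ 2) \in Lfun P 1.
    apply: Lfun1_ae (Lfun1B dXeL1 (mulL1 dXLp yLq)).
      apply: measurable_funM => //; apply: measurable_funX.
      exact: measurable_funB.
    by apply: filterS2 eab yab => w /= -> -> _; ring.
  have cdXY : centered P Z (fun w =>
      (X w - x (Z w)) * (Y w - y (Z w)) - b (Z w) * (X w - x (Z w)) ^+ 2).
    have cYyb : centered P XZ (fun w =>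
        (Y w - y (Z w)) - b (Z w) * (X w - x (Z w))).
      apply: (centered_ae mXZ _ _ cYab).
        apply: measurable_funB; first exact: measurable_funB.
        by apply: measurable_funM => //; exact: measurable_funB.
      by apply: filterS yab => w /= -> _; ring.
    apply: centered_XZ.
    have := centered_mul mXZ cYyb mdx; rewrite /XZ /=.
    have -> : (fun w => (X w - x (Z w)) *
        (Y w - y (Z w) - b (Z w) * (X w - x (Z w)))) =
      (fun w => (X w - x (Z w)) * (Y w - y (Z w)) -
         b (Z w) * (X w - x (Z w)) ^+ 2) by apply/funext => w; ring.
    by apply; exact: Lfun1B.
  have bcL1 := condexp_mul_Lfun1 mZ dX2L1 mc cc mb bdX2L1.
  have cbc : centered P Z (fun w =>
      b (Z w) * ((X w - x (Z w)) ^+ 2 - c (Z w))).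
    apply: (centered_mul mZ cc mb).
    by have := Lfun1B bdX2L1 bcL1; under eq_fun do rewrite -mulrBr.
  suff : condcov P Z X Y = (fun s => b s * c s) \o Z %[ae P].
    by apply: filterS => w /= /(_ I); rewrite varE.
  rewrite covE; apply: (condexp_unique mZ dXYL1 (measurable_funM mb mc)).
  have := centeredD mZ cdXY cbc.
  by congr centered; apply/funext => w /=; ring.
(* the integral of (X - x(Z))^2 over the event Var <= 0 is that of Var *)
- pose B := [set s | c s <= 0].
  have mB : measurable B.
    by rewrite -[X in measurable X]setTI; exact: measurable_fun_le.
  have mZB := measurable_preim mZ mB.
  have mdX2 : measurable_fun (Z @^-1` B) (EFin \o fun w => (X w - x (Z w)) ^+ 2).
    exact/measurable_EFinP/measurable_funTS/(Lfun_measurable dX2L1).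
  have cL1 : (c \o Z) \in Lfun P 1.
    exact: (version_Lfun1 dX2L1 cc).
  have : (\int[P]_(w in Z @^-1` B) `|((X w - x (Z w)) ^+ 2)%:E| = 0)%E.
    apply/eqP; rewrite eq_le integral_ge0 ?andbT//.
    under eq_integral do rewrite gee0_abs ?lee_fin ?sqr_ge0//.
    have : (\int[P]_(w in Z @^-1` B)
        (((X w - x (Z w)) ^+ 2)%:E - (c (Z w))%:E) = 0)%E.
      by rewrite -(cc.2 B mB); apply: eq_integral.
    rewrite integralB//; [|exact: Lfun1_integrableS..].
    have fin D : D \in Lfun P 1 ->
        (\int[P]_(w in Z @^-1` B) (D w)%:E)%E \is a fin_num.
      by move=> DL1; apply: integrable_fin_num => //; exact: Lfun1_integrableS.
    rewrite -(fineK (fin _ dX2L1)) -(fineK (fin _ cL1)) -EFinB => /eqP.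
    rewrite eqe subr_eq0 => /eqP ->; rewrite fineK ?fin//.
    rewrite -[leRHS](integral0 P (Z @^-1` B)); apply: le_integral => //.
    - exact: Lfun1_integrableS.
    - exact: integrable0.
    - by move=> w /set_mem cw; rewrite lee_fin.
  move=> /(ae_eq_integral_abs P mZB mdX2); apply: filterS => w /= h.
  rewrite varE xE => cw.
  by have [/eqP] := h cw; rewrite sqrf_eq0 subr_eq0 => /eqP.
Qed.

End conditional_regression.

Section regression_conclusions.
Context {d d' : measure_display} {T : measurableType d} {S : measurableType d'}.
Context {R : realType} (P : probability T R) (Z : T -> S).
Hypothesis mZ : measurable_fun setT Z.
Variables (p q : \bar R) (X Y : T -> R).
Hypotheses (p1 : (1 <= p)%E) (q1 : (1 <= q)%E) (pq : (p^-1 + q^-1 = 1)%E).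
Hypotheses (XLp : X \in Lfun P p) (YLq : Y \in Lfun P q).
Hypothesis p2 : (2%:E <= p)%E.

Let coefs := affine_condexp_coefficients mZ p1 q1 pq XLp YLq p2.

(** A given slope b is determined only where the conditional variance is
positive; the pair (a', b') normalizes it to 0 elsewhere.  There a + b X equals
y(Z), which keeps the new pair a representation, and a' is equal to a or to y,
which keeps a'(Z) and a'(Z) X integrable. *)
Lemma affine_condexp_slope (a b : S -> R) : affine_condexp P Z X Y a b ->
  [/\ (fun w => a (Z w))
        = (fun w => condexp P Z Y w - b (Z w) * condexp P Z X w) %[ae P],
      (fun w => b (Z w) * \1_[set v | 0 < condvar P Z X v] w)
        = (fun w => condcov P Z X Y w / condvar P Z X w
                    * \1_[set v | 0 < condvar P Z X v] w) %[ae P] &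
      exists a' b' : S -> R,
        [/\ affine_condexp P Z X Y a' b',
            (fun w => a' (Z w))
              = (fun w => condexp P Z Y w - b' (Z w) * condexp P Z X w)
              %[ae P] &
            (fun w => b' (Z w))
              = (fun w => condcov P Z X Y w / condvar P Z X w
                          * \1_[set v | 0 < condvar P Z X v] w) %[ae P]]].
Proof.
move=> ab; have [yab cov_b X_x] := coefs ab; split.
- by apply: filterS yab => w -> _; rewrite addrK.
- apply: filterS cov_b => w -> _; rewrite indicE; case: (boolP (w \in _)).
    by rewrite inE/= => v0; rewrite mulfK// gt_eqF.
  by rewrite !mulr0.
case: ab => ma mb aL1 aXL1 eab.
have mX := Lfun_measurable XLp; have mY := Lfun_measurable YLq.
have XL1 := Lfun1_sub p1 XLp; have YL1 := Lfun1_sub q1 YLq.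
have [x [mx xE cx]] := condexp_spec mZ XL1.
have [y [my yE cy]] := condexp_spec mZ YL1.
have yLq := condexp_Lfun mZ YL1 my cy q1 YLq.
have yL1 : (y \o Z) \in Lfun P 1 by exact: Lfun1_sub yLq.
have yXL1 : (fun w => y (Z w) * X w) \in Lfun P 1.
  by under eq_fun do rewrite mulrC; exact: (Lfun_mul_conjugate p1 q1 pq).
have [c mc cE] : exists2 c : S -> R, measurable_fun setT c &
  condcov P Z X Y = c \o Z by exact: condexp_factor.
have [v mv vE] : exists2 v : S -> R, measurable_fun setT v &
  condvar P Z X = v \o Z by exact: condexp_factor.
(* off the event v > 0 the slope is 0, so a' is there equal to y *)
pose b' s := if 0 < v s then c s / v s else 0.
pose a' s := y s - b' s * x s.
have mb' : measurable_fun setT b'.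
  (* on positive reals the inverse is the power of exponent -1, whose
     measurability is known *)
  have -> : b' = fun s => if 0 < v s then c s * v s `^ (-1) else 0.
    by apply/funext => s; rewrite /b'; case: ltP => // v0; rewrite powR_inv1// ltW.
  apply: measurable_fun_ifT => //; first exact: measurable_fun_ltr.
  apply: measurable_funM => //.
  exact: (measurableT_comp (measurable_powR _)).
have ma' : measurable_fun setT a'.
  by apply: measurable_funB => //; exact: measurable_funM.
have maZ : measurable_fun setT (a' \o Z) by exact: measurableT_comp.
(* a' + b' X agrees with a + b X on both sides of the event Var > 0 *)
have aba'b' : \forall w \ae P, if 0 < v (Z w)
    then a' (Z w) = a (Z w) /\ b' (Z w) = b (Z w)
    else [/\ a' (Z w) = y (Z w), b' (Z w) = 0 & a (Z w) + b (Z w) * X w = y (Z w)].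
  near=> w.
  have yw : y (Z w) = a (Z w) + b (Z w) * x (Z w).
    by rewrite -[LHS]/((y \o Z) w) -[x _]/((x \o Z) w) -yE -xE; near: w.
  have cw : c (Z w) = b (Z w) * v (Z w).
    by rewrite -[LHS]/((c \o Z) w) -[v _]/((v \o Z) w) -cE -vE; near: w.
  rewrite /a' /b'; case: ltP => [v0|v0].
    by rewrite cw mulfK ?gt_eqF// yw addrK.
  rewrite mul0r subr0; split => //; rewrite yw; congr (_ + _ * _).
  by rewrite -[RHS]/((x \o Z) w) -xE (near X_x w)// vE.
exists a', b'; split.
- split => //.
  + apply: Lfun1_ae_or aL1 yL1 => //.
    by apply: filterS aba'b' => w; case: ifPn => _ []; [left|right].
  + apply: Lfun1_ae_or aXL1 yXL1; first exact: measurable_funM.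
    by apply: filterS aba'b' => w; case: ifPn => _ [] -> _; [left|right].
  + apply: filterS2 eab aba'b' => w /= /(_ I) ->.
    by case: ifPn => _ [-> ->] // ->; rewrite mul0r addr0.
- by apply: aeW => w _; rewrite yE xE.
- apply: aeW => w _; rewrite cE vE indicE /b' /=.
  case: ifPn => v0; first by rewrite mem_set// mulr1.
  by rewrite memNset ?mulr0//=; exact/negP.
Unshelve. all: by end_near. Qed.

Lemma affine_condexp_uncorrelated (a b : S -> R) : affine_condexp P Z X Y a b ->
  condcov P Z X Y = (fun=> 0) %[ae P] ->
  condexp P (fun w => (X w, Z w)) Y = condexp P Z Y %[ae P].
Proof.
move=> ab cov0; have [yab cov_b X_x] := coefs ab; case: ab => _ _ _ _ eab.
have eabZ : \forall w \ae P, condexp P (fun w => (X w, Z w)) Y w =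
    a (Z w) + b (Z w) * X w by apply: filterS eab => w; exact.
have {}cov0 : \forall w \ae P, condcov P Z X Y w = 0.
  by apply: filterS cov0 => w; exact.
near=> w => _.
rewrite (near eabZ w)//.
have -> : condexp P Z Y w = a (Z w) + b (Z w) * condexp P Z X w by near: w.
have [v0|v0] := leP (condvar P Z X w) 0; first by rewrite -(near X_x w).
suff -> : b (Z w) = 0 by rewrite !mul0r.
have : b (Z w) * condvar P Z X w = 0.
  by rewrite -(near cov_b w)// (near cov0 w).
by move/eqP; rewrite mulf_eq0 (gt_eqF v0) orbF => /eqP.
Unshelve. all: by end_near.
Qed.

End regression_conclusions.

(** * Both regressions together *)

Theorem theorem1 (d d' : measure_display) (T : measurableType d)
    (S : measurableType d') (R : realType) (P : probability T R)
    (Z : {RV P >-> S}) (p q : \bar R) (X Y : T -> R)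
    (p_ge1 : (1 <= p)%E) (q_ge1 : (1 <= q)%E)
    (conj_pq : (p^-1 + q^-1 = 1)%E)
    (XLp : X \in Lfun P p) (YLq : Y \in Lfun P q) :
  (* (i) *)
  ((2%:E <= maxe p q)%E /\ (mine p q <= 2%:E)%E) /\
  (* (ii) *)
  (condexp P (fun w => (X w, Z w)) Y = condexp P Z Y %[ae P] ->
   condcov P Z X Y = (fun=> 0) %[ae P] /\
   exists alpha beta : S -> R, affine_condexp P Z X Y alpha beta) /\
  (* (iii) *)
  ((2%:E <= p)%E -> forall alpha beta : S -> R,
   affine_condexp P Z X Y alpha beta ->
   [/\ (fun w => alpha (Z w))
         = (fun w => condexp P Z Y w - beta (Z w) * condexp P Z X w) %[ae P],
       (fun w => beta (Z w) * \1_[set v | 0 < condvar P Z X v] w)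
         = (fun w => condcov P Z X Y w / condvar P Z X w
                     * \1_[set v | 0 < condvar P Z X v] w) %[ae P] &
       exists alpha' beta' : S -> R,
         [/\ affine_condexp P Z X Y alpha' beta',
             (fun w => alpha' (Z w))
               = (fun w => condexp P Z Y w - beta' (Z w) * condexp P Z X w)
               %[ae P] &
             (fun w => beta' (Z w))
               = (fun w => condcov P Z X Y w / condvar P Z X w
                           * \1_[set v | 0 < condvar P Z X v] w) %[ae P]]]) /\
  (* (iv) *)
  ((2%:E <= p)%E ->
   (exists alpha beta : S -> R, affine_condexp P Z X Y alpha beta) ->
   condcov P Z X Y = (fun=> 0) %[ae P] ->
   condexp P (fun w => (X w, Z w)) Y = condexp P Z Y %[ae P]) /\
  (* (v) *)
  (condexp P (fun w => (Y w, Z w)) X = condexp P Z X %[ae P] ->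
   condcov P Z X Y = (fun=> 0) %[ae P] /\
   exists gamma delta : S -> R, affine_condexp P Z Y X gamma delta) /\
  (* (vi) *)
  ((2%:E <= q)%E -> forall gamma delta : S -> R,
   affine_condexp P Z Y X gamma delta ->
   [/\ (fun w => gamma (Z w))
         = (fun w => condexp P Z X w - delta (Z w) * condexp P Z Y w) %[ae P],
       (fun w => delta (Z w) * \1_[set v | 0 < condvar P Z Y v] w)
         = (fun w => condcov P Z X Y w / condvar P Z Y w
                     * \1_[set v | 0 < condvar P Z Y v] w) %[ae P] &
       exists gamma' delta' : S -> R,
         [/\ affine_condexp P Z Y X gamma' delta',
             (fun w => gamma' (Z w))
               = (fun w => condexp P Z X w - delta' (Z w) * condexp P Z Y w)
               %[ae P] &
             (fun w => delta' (Z w))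
               = (fun w => condcov P Z X Y w / condvar P Z Y w
                           * \1_[set v | 0 < condvar P Z Y v] w) %[ae P]]]) /\
  (* (vii) *)
  ((2%:E <= q)%E ->
   (exists gamma delta : S -> R, affine_condexp P Z Y X gamma delta) ->
   condcov P Z X Y = (fun=> 0) %[ae P] ->
   condexp P (fun w => (Y w, Z w)) X = condexp P Z X %[ae P]).
Proof.
have mZ : measurable_fun setT Z by [].
have qp : (q^-1 + p^-1 = 1)%E by rewrite addeC.
have covC U V : condcov P Z U V = condcov P Z V U.
  by rewrite /condcov; congr condexp; apply/funext => w; rewrite mulrC.
split; first exact: conjugate_exponents_2.
split; first exact: (condcov_condexp_eq mZ p_ge1 q_ge1 conj_pq).
split; first by move=> p2 a b; exact: (affine_condexp_slope mZ p_ge1 q_ge1 conj_pq).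
split.
  move=> p2 [a [b ab]].
  exact: (affine_condexp_uncorrelated mZ p_ge1 q_ge1 conj_pq XLp YLq p2 ab).
(* the remaining three conclusions are the previous ones for the pair (Y, X) *)
rewrite (covC X Y).
split; first exact: (condcov_condexp_eq mZ q_ge1 p_ge1 qp).
split; first by move=> q2 a b; exact: (affine_condexp_slope mZ q_ge1 p_ge1 qp).
move=> q2 [a [b ab]].
exact: (affine_condexp_uncorrelated mZ q_ge1 p_ge1 qp YLq XLp q2 ab).
Qed.
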